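(* Let $n,p,m,n_o,\nu\ge1$ be integers, let $F:\mathbb{R}^n\to\mathbb{R}^n$, $G:\mathbb{R}^n\to\mathbb{R}^n$, $H:\mathbb{R}^n\to\mathbb{R}^p$, $J:\mathbb{R}^n\to\mathbb{R}^p$, $E:\mathbb{R}^n\to\mathbb{R}^{n\times m}$, $K:\mathbb{R}^n\to\mathbb{R}^{p\times m}$ be smooth, let $R\in\mathbb{R}^{n_o\times n_o}$, $Q\in\mathbb{R}^{1\times n_o}$, and let $\alpha_1,\ldots,\alpha_\nu\in\mathbb{R}$. Write $\tilde H(x,x_o)=H(x)+J(x)Qx_o$. Suppose that there exist constant row vectors $\beta_0,\beta_1,\ldots,\beta_\nu\in\mathbb{R}^p$ (regarded as $1\times p$ matrices) such that, for all $(x,x_o)\in\mathbb{R}^n\times\mathbb{R}^{n_o}$, $$L_{F_e}^\nu(\beta_0\tilde H)+L_{F_e}^{\nu-1}(\beta_1\tilde H)+\cdots+L_{F_e}(\beta_{\nu-1}\tilde H)+\beta_\nu\tilde H=Q\big(R^\nu+\alpha_1R^{\nu-1}+\cdots+\alpha_{\nu-1}R+\alpha_\nu I\big)x_o,$$ and that the matrices $A,B,C,D$ are chosen as $$A=\begin{bmatrix}0&0&\cdots&0&-\alpha_\nu\\1&0&\cdots&0&-\alpha_{\nu-1}\\\vdots&\ddots&\ddots&\vdots&\vdots\\0&\cdots&1&0&-\alpha_2\\0&\cdots&0&1&-\alpha_1\end{bmatrix},\quad B=\begin{bmatrix}\beta_\nu-\alpha_\nu\beta_0\\\beta_{\nu-1}-\alpha_{\nu-1}\beta_0\\\vdots\\\beta_1-\alpha_1\beta_0\end{bmatrix},\quad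 C=[0\ 0\ \cdots\ 0\ 1],\quad D=\beta_0,$$ so that the functional observer conditions $$\frac{\partial T}{\partial x}(x,x_o)\big(F(x)+G(x)Qx_o\big)+\frac{\partial T}{\partial x_o}(x,x_o)Rx_o=AT(x,x_o)+B\tilde H(x,x_o),\qquad CT(x,x_o)+D\tilde H(x,x_o)=Qx_o$$ hold with the mapping $T=(T_1,\ldots,T_\nu)^{\top}:\mathbb{R}^{n+n_o}\to\mathbb{R}^\nu$ given, for $i=1,\ldots,\nu$, by $$T_i(x,x_o)=Q\big(R^{\nu-i}+\alpha_1R^{\nu-i-1}+\cdots+\alpha_{\nu-i}I\big)x_o-\sum_{\ell=0}^{\nu-i}L_{F_e}^{\nu-i-\ell}\big(\beta_\ell\tilde H\big)(x,x_o)$$ (in particular $T_\nu(x,x_o)=Qx_o-\beta_0\tilde H(x,x_o)$). Then the functional observer $\frac{d\hat\xi}{dt}=A\hat\xi+By$, $\hat f=C\hat\xi+Dy$ satisfies the disturbance decoupling conditions $$-\frac{\partial T}{\partial x}(x,x_o)E(x)+BK(x)=0,\qquad DK(x)=0\qquad\text{for all }(x,x_o)\in\mathbb{R}^n\times\mathbb{R}^{n_o}$$ if and only if, for all $(x,x_o)\in\mathbb{R}^n\times\mathbb{R}^{n_o}$, $$\sum_{\ell=0}^{\nu-\kappa}L_EL_{F_e}^{\nu-\kappa-\ell}\big(\beta_\ell\tilde H\big)(x,x_o)+\beta_{\nu-\kappa+1}K(x)=0,\quad \kappa=1,\ldots,\nu,\qquad\text{and}\qquad \beta_0K(x)=0.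$$
   Context: The setting is the system $\frac{dx}{dt}=F(x)+G(x)Qx_o+E(x)W$, $\frac{dx_o}{dt}=Rx_o$, $y=H(x)+J(x)Qx_o+K(x)W$, $z=Qx_o$, where $x\in\mathbb{R}^n$, $x_o\in\mathbb{R}^{n_o}$, $W\in\mathbb{R}^m$ is a disturbance and $f=Qx_o$ is the fault to be estimated by the output $\hat f$ of the observer $\frac{d\hat\xi}{dt}=A\hat\xi+By$, $\hat f=C\hat\xi+Dy$. The operator $L_{F_e}$ acts on smooth functions on $\mathbb{R}^n\times\mathbb{R}^{n_o}$ by $$L_{F_e}=\sum_{k=1}^nF_k(x)\frac{\partial}{\partial x_k}+Qx_o\sum_{k=1}^nG_k(x)\frac{\partial}{\partial x_k}+\sum_{k=1}^{n_o}R_kx_o\frac{\partial}{\partial x_{o_k}},$$ where $R_k$ is the $k$-th row of $R$; $L_{F_e}^j$ is its $j$-fold iterate ($L_{F_e}^0$ is the identity). For a smooth real-valued $h(x,x_o)$, $L_Eh(x,x_o)=\frac{\partial h}{\partial x}(x,x_o)E(x)$, a $1\times m$ row vector (differentiation only with respect to $x$). For $\nu=1$ the matrix $A$ is the $1\times1$ matrix $-\alpha_1$, $B=\beta_1-\alpha_1\beta_0$ and $C=1$. *)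

(* Defs.v *)
From HB Require Import structures.
From mathcomp Require Import all_boot all_order all_algebra.
From mathcomp Require Import boolp classical_sets reals topology normedtype derive.
Set Implicit Arguments.
Unset Strict Implicit.
Unset Printing Implicit Defensive.
Import Order.TTheory GRing.Theory Num.Theory.
Import numFieldNormedType.Exports.
Local Open Scope ring_scope.

(* MathComp / MathComp-Analysis development.  R is an arbitrary model of the
   real numbers (realType); since the letter R is taken by the field, the matrix
   of the exosystem dx_o/dt = R x_o is written Ro.  Vectors of R^n are columns
   'cV[R]_n, and a point (x, x_o) is a pair z : 'cV[R]_n * 'cV[R]_no. *)

(* Only used between finite-dimensional spaces, where it is the usual C^k:
   for k > 0 the conditions amount to the existence and continuity of all
   partial derivatives up to order k. *)
Fixpoint class_C (R : realType) (V W : normedModType R) (k : nat) (f : V -> W)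
    : Prop :=
  if k is k'.+1 then
    (forall x, differentiable f x) /\
    (forall v : V, class_C k' (fun x => 'D_v f x))
  else continuous f.

Definition smooth (R : realType) (V W : normedModType R) (f : V -> W) : Prop :=
  forall k, class_C k f.

Definition partial_x (R : realType) (n no : nat) (k : 'I_n)
    (h : 'cV[R]_n * 'cV[R]_no -> R) (z : 'cV[R]_n * 'cV[R]_no) : R :=
  'D_(delta_mx k 0, 0) h z.

Definition partial_xo (R : realType) (n no : nat) (k : 'I_no)
    (h : 'cV[R]_n * 'cV[R]_no -> R) (z : 'cV[R]_n * 'cV[R]_no) : R :=
  'D_(0, delta_mx k 0) h z.

(* dT/dx and dT/dx_o, of sizes nu x n and nu x no. *)
Definition jacobian_x (R : realType) (n no nu : nat)
    (T : 'cV[R]_n * 'cV[R]_no -> 'cV[R]_nu) (z : 'cV[R]_n * 'cV[R]_no)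
    : 'M[R]_(nu, n) :=
  \matrix_(i, k) partial_x k (fun w => T w i 0) z.

Definition jacobian_xo (R : realType) (n no nu : nat)
    (T : 'cV[R]_n * 'cV[R]_no -> 'cV[R]_nu) (z : 'cV[R]_n * 'cV[R]_no)
    : 'M[R]_(nu, no) :=
  \matrix_(i, k) partial_xo k (fun w => T w i 0) z.

Definition L_Fe (R : realType) (n no : nat) (F G : 'cV[R]_n -> 'cV[R]_n)
    (Ro : 'M[R]_no) (Q : 'rV[R]_no) (h : 'cV[R]_n * 'cV[R]_no -> R)
    (z : 'cV[R]_n * 'cV[R]_no) : R :=
  let: (x, xo) := z in
  \sum_k F x k 0 * partial_x k h z
  + (Q *m xo) 0 0 * (\sum_k G x k 0 * partial_x k h z)
  + \sum_k (row k Ro *m xo) 0 0 * partial_xo k h z.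

Definition L_E (R : realType) (n no m : nat) (E : 'cV[R]_n -> 'M[R]_(n, m))
    (h : 'cV[R]_n * 'cV[R]_no -> R) (z : 'cV[R]_n * 'cV[R]_no) : 'rV[R]_m :=
  (\row_k partial_x k h z) *m E z.1.

Definition Htilde (R : realType) (n no p : nat) (H J : 'cV[R]_n -> 'cV[R]_p)
    (Q : 'rV[R]_no) (z : 'cV[R]_n * 'cV[R]_no) : 'cV[R]_p :=
  let: (x, xo) := z in H x + J x *m (Q *m xo).

(* beta * Htilde as a real-valued function. *)
Definition betaH (R : realType) (n no p : nat) (H J : 'cV[R]_n -> 'cV[R]_p)
    (Q : 'rV[R]_no) (b : 'rV[R]_p) (z : 'cV[R]_n * 'cV[R]_no) : R :=
  (b *m Htilde H J Q z) 0 0.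

(* Ro^j + alpha_1 Ro^(j-1) + ... + alpha_j I.  The coefficients alpha_l and
   beta_l are given as nat-indexed families, of which only alpha_1..alpha_nu
   and beta_0..beta_nu are ever read. *)
Definition alpha_poly (R : realType) (no : nat) (alpha : nat -> R)
    (Ro : 'M[R]_no) (j : nat) : 'M[R]_no :=
  Ro ^+ j + \sum_(1 <= l < j.+1) alpha l *: Ro ^+ (j - l).

(* Ordinals start at 0: the i-th row below is row i.+1 of the matrix in the
   usual 1-based numbering. *)
Definition obs_A (R : realType) (nu : nat) (alpha : nat -> R) : 'M[R]_nu :=
  \matrix_(i, j) if j == nu.-1 :> nat then - alpha (nu - i)%N
                 else (i == j.+1 :> nat)%:R.

Definition obs_B (R : realType) (nu p : nat) (alpha : nat -> R)
    (beta : nat -> 'rV[R]_p) : 'M[R]_(nu, p) :=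
  \matrix_(i, j) (beta (nu - i)%N - alpha (nu - i)%N *: beta 0%N) 0 j.

Definition obs_C (R : realType) (nu : nat) : 'rV[R]_nu :=
  \row_j (j == nu.-1 :> nat)%:R.

Definition obs_D (R : realType) (p : nat) (beta : nat -> 'rV[R]_p) : 'rV[R]_p :=
  beta 0%N.

Definition obs_T (R : realType) (n no p nu : nat) (F G : 'cV[R]_n -> 'cV[R]_n)
    (H J : 'cV[R]_n -> 'cV[R]_p) (Ro : 'M[R]_no) (Q : 'rV[R]_no)
    (alpha : nat -> R) (beta : nat -> 'rV[R]_p) (z : 'cV[R]_n * 'cV[R]_no)
    : 'cV[R]_nu :=
  \col_(i < nu)
    ((Q *m alpha_poly alpha Ro (nu - i.+1) *m z.2) 0 0
     - \sum_(0 <= l < (nu - i.+1).+1)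
         iter (nu - i.+1 - l) (L_Fe F G Ro Q) (betaH H J Q (beta l)) z).

Definition functional_observer_conditions (R : realType) (n no p nu : nat)
    (F G : 'cV[R]_n -> 'cV[R]_n) (H J : 'cV[R]_n -> 'cV[R]_p) (Ro : 'M[R]_no)
    (Q : 'rV[R]_no) (A : 'M[R]_nu) (B : 'M[R]_(nu, p)) (C : 'rV[R]_nu)
    (D : 'rV[R]_p) (T : 'cV[R]_n * 'cV[R]_no -> 'cV[R]_nu) : Prop :=
  forall (x : 'cV[R]_n) (xo : 'cV[R]_no),
    jacobian_x T (x, xo) *m (F x + G x *m (Q *m xo))
      + jacobian_xo T (x, xo) *m (Ro *m xo)
    = A *m T (x, xo) + B *m Htilde H J Q (x, xo)
    /\ C *m T (x, xo) + D *m Htilde H J Q (x, xo) = Q *m xo.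

Definition disturbance_decoupling_conditions (R : realType) (n no p m nu : nat)
    (E : 'cV[R]_n -> 'M[R]_(n, m)) (K : 'cV[R]_n -> 'M[R]_(p, m))
    (B : 'M[R]_(nu, p)) (D : 'rV[R]_p)
    (T : 'cV[R]_n * 'cV[R]_no -> 'cV[R]_nu) : Prop :=
  forall (x : 'cV[R]_n) (xo : 'cV[R]_no),
    - (jacobian_x T (x, xo) *m E x) + B *m K x = 0 /\ D *m K x = 0.

(* Main.v *)
Require Import Defs.
From HB Require Import structures.
From mathcomp Require Import all_boot all_order all_algebra.
From mathcomp Require Import ring.
From mathcomp Require Import boolp classical_sets reals topology normedtype derive.
Set Implicit Arguments.
Unset Strict Implicit.
Unset Printing Implicit Defensive.
Import Order.TTheory GRing.Theory Num.Theory.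
Import numFieldNormedType.Exports.
Local Open Scope ring_scope.

(** Both halves come down to one recursion.  For j = 0, 1, ..., put
      t_j = Q P_j x_o - S_j,
      P_j = Ro^j + alpha_1 Ro^(j-1) + ... + alpha_j I,
      S_j = sum over l <= j of L^(j-l) (beta_l Htilde),     L = L_Fe,
    so that the i-th row of T, counted from 0, is t_(nu-i-1).  Since
    P_(j+1) = P_j Ro + alpha_(j+1) I and S_(j+1) = L S_j + beta_(j+1) Htilde,
    and since t_0 = Q x_o - beta_0 Htilde,
      L t_j = t_(j+1) - alpha_(j+1) t_0
              + (beta_(j+1) - alpha_(j+1) beta_0) Htilde       [L_obs_coord].
    The assumption on beta says exactly that t_nu = 0.  The left-hand side of
    the first observer condition is L applied to the rows of T, because L is
    the derivative along the vector field of the fault-extended system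
    [L_FeE, jacobian_mulE]; A shifts the sequence t by one place and subtracts
    alpha times t_0 [obs_A_mul], so the recursion is that condition row by row.
    The second condition is the formula for t_0.

    For disturbance decoupling, Q P_j x_o does not depend on x, hence
    L_E t_j = - L_E S_j [L_E_obs_coord].  Row i of -(dT/dx) E + B K is therefore
    L_E S_(nu-i-1) + (beta_(nu-i) - alpha_(nu-i) beta_0) K, and beta_0 K = 0
    removes the term with alpha; what remains is the condition of index
    kappa = i + 1.

    The recursion differentiates sums term by term, so every iterated Lie
    derivative of beta_l Htilde has to be differentiable.  This is where the
    smoothness of F, G, H and J enters: smooth functions are stable under sums,
    products and directional derivatives, hence under L [smooth_L_Fe]. *)

(** * Functions of class C^k *)

Section DirectionalDerivative.
Variables (R : realType) (U V W : normedModType R).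

Lemma derive_comp_lin (l : {linear V -> W}) (f : U -> V) (v : U) (x : U) :
  continuous l -> differentiable f x -> 'D_v (l \o f) x = l ('D_v f x).
Proof.
move=> lc df; have dl := linear_differentiable (f x) lc.
rewrite (deriveE v df) deriveE; last exact: differentiable_comp.
by rewrite diff_comp //= diff_lin.
Qed.

Lemma derive_lin_comp (f : V -> W) (l : {linear U -> V}) (v : U) (x : U) :
  continuous l -> differentiable f (l x) ->
  'D_v (f \o l) x = 'D_(l v) f (l x).
Proof.
move=> lc df; have dl := linear_differentiable x lc.
rewrite (deriveE (l v) df) deriveE; last exact: differentiable_comp.
by rewrite diff_comp //= diff_lin.
Qed.

Lemma derive_lin (l : {linear U -> V}) (v : U) (x : U) :
  continuous l -> 'D_v l x = l v.
Proof.
move=> lc; have dl := linear_differentiable x lc.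
by rewrite deriveE // diff_lin.
Qed.

End DirectionalDerivative.

Section ClassC.
Variable R : realType.
Implicit Types (U V W : normedModType R) (k : nat).

Lemma eq_class_C V W k (f g : V -> W) : f =1 g -> class_C k f -> class_C k g.
Proof. by move=> /funext->. Qed.

(** The C^k classes are nested; the product rule needs it, because the
    derivative of a product contains the undifferentiated factors. *)
Lemma class_CS V W k (f : V -> W) : class_C k.+1 f -> class_C k f.
Proof.
elim: k f => [|k IH] f [fd fD].
  by move=> x; apply: differentiable_continuous.
by split=> // v; apply: IH.
Qed.

Lemma class_C_cst V W k (a : W) : class_C k (fun _ : V => a).
Proof.
elim: k a => [|k IH] a; first exact: cst_continuous.
split=> [x|v]; first exact: differentiable_cst.
by apply: eq_class_C (IH 0) => x; rewrite derive_cst.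
Qed.

Lemma class_C_lin V W k (l : {linear V -> W}) : continuous l -> class_C k l.
Proof.
move=> lc; case: k => [//|k]; split=> [x|v].
  exact: linear_differentiable.
by apply: eq_class_C (class_C_cst V k (l v)) => x; rewrite derive_lin.
Qed.

Lemma class_C_comp_lin U V W k (l : {linear V -> W}) (f : U -> V) :
  continuous l -> class_C k f -> class_C k (l \o f).
Proof.
move=> lc; elim: k f => [|k IH] f /=.
  by move=> fc x; apply: continuous_comp; [exact: fc | exact: lc].
move=> [fd fD]; split=> [x|v].
  by apply: differentiable_comp => //; exact: linear_differentiable.
by apply: eq_class_C (IH _ (fD v)) => x; rewrite derive_comp_lin.
Qed.

Lemma class_C_lin_comp U V W k (f : V -> W) (l : {linear U -> V}) :
  continuous l -> class_C k f -> class_C k (f \o l).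
Proof.
move=> lc; elim: k f => [|k IH] f /=.
  by move=> fc x; apply: continuous_comp; [exact: lc | exact: fc].
move=> [fd fD]; split=> [x|v].
  by apply: differentiable_comp => //; exact: linear_differentiable.
by apply: eq_class_C (IH _ (fD (l v))) => x; rewrite derive_lin_comp.
Qed.

Lemma class_CD V W k (f g : V -> W) :
  class_C k f -> class_C k g -> class_C k (f \+ g).
Proof.
elim: k f g => [|k IH] f g /=.
  by move=> fc gc x; apply: continuousD; [exact: fc | exact: gc].
move=> [fd fD] [gd gD]; split=> [x|v]; first exact: differentiableD.
apply: eq_class_C (IH _ _ (fD v) (gD v)) => x.
by rewrite deriveD //; exact: diff_derivable.
Qed.

Lemma class_CM V k (f g : V -> R) :
  class_C k f -> class_C k g -> class_C k (f \* g).
Proof.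
elim: k f g => [|k IH] f g.
  by move=> fc gc x; apply: continuousM; [exact: fc | exact: gc].
move=> fC gC; have [fd fD] := fC; have [gd gD] := gC.
split=> [x|v]; first exact: differentiableM.
have fgD := IH _ _ (class_CS fC) (gD v).
have gfD := IH _ _ (class_CS gC) (fD v).
apply: eq_class_C (class_CD fgD gfD) => x.
by rewrite deriveM //; exact: diff_derivable.
Qed.

End ClassC.

Lemma fst_continuous (R : realType) (V W : normedModType R) :
  continuous (fst : V * W -> V).
Proof. by move=> x; exact: cvg_fst. Qed.

Lemma snd_continuous (R : realType) (V W : normedModType R) :
  continuous (snd : V * W -> W).
Proof. by move=> x; exact: cvg_snd. Qed.

(** The coordinate map is named so that it can carry a linear structure, which
    brings matrix coefficients under [class_C_comp_lin]. *)
Definition mx_coord (R : pzRingType) (m n : nat) (i : 'I_m) (j : 'I_n)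
    (A : 'M[R]_(m, n)) : R := A i j.

Section MxCoordLinear.
Variables (R : pzRingType) (m n : nat) (i : 'I_m) (j : 'I_n).

Lemma mx_coord_is_linear : linear (@mx_coord R m n i j : _ -> R^o).
Proof. by move=> a A B; rewrite /mx_coord !mxE. Qed.

HB.instance Definition _ :=
  GRing.isLinear.Build R 'M[R]_(m, n) R^o *:%R (@mx_coord R m n i j)
    mx_coord_is_linear.

End MxCoordLinear.

(** * Smooth functions *)

Section Smooth.
Variable R : realType.
Implicit Types (V W : normedModType R).

Lemma smooth_differentiable V W (f : V -> W) x : smooth f -> differentiable f x.
Proof. by move=> fs; have [fd _] := fs 1%N; exact: fd. Qed.

Lemma smooth_derive V W (f : V -> W) v : smooth f -> smooth (fun x => 'D_v f x).
Proof. by move=> fs k; have [_ fD] := fs k.+1; exact: fD. Qed.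

Lemma eq_smooth V W (f g : V -> W) : f =1 g -> smooth f -> smooth g.
Proof. by move=> /funext->. Qed.

Lemma smooth_cst V W (a : W) : smooth (fun _ : V => a).
Proof. by move=> k; exact: class_C_cst. Qed.

Lemma smoothD V W (f g : V -> W) :
  smooth f -> smooth g -> smooth (fun x => f x + g x).
Proof. by move=> fs gs k; exact: class_CD. Qed.

Lemma smoothM V (f g : V -> R) :
  smooth f -> smooth g -> smooth (fun x => f x * g x).
Proof. by move=> fs gs k; exact: class_CM. Qed.

Lemma smooth_sum V W (I : Type) (r : seq I) (f : I -> V -> W) :
  (forall i, smooth (f i)) -> smooth (fun x => \sum_(i <- r) f i x).
Proof.
move=> fs; elim: r => [|i r IH].
  apply: (@eq_smooth _ _ (fun=> 0)); last exact: smooth_cst.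
  by move=> x; rewrite big_nil.
apply: (@eq_smooth _ _ (fun x => f i x + \sum_(j <- r) f j x)).
  by move=> x; rewrite big_cons.
exact: smoothD.
Qed.

Lemma derive_sum_seq V W (I : Type) (r : seq I) (f : I -> V -> W) v x :
  (forall i, smooth (f i)) ->
  'D_v (fun x => \sum_(i <- r) f i x) x = \sum_(i <- r) 'D_v (f i) x.
Proof.
move=> fs; elim: r => [|i r IH].
  rewrite big_nil -[RHS](derive_cst (0 : W) x v); congr ('D_v _ x).
  by apply/funext => y; rewrite big_nil.
rewrite big_cons -IH -deriveD; [congr ('D_v _ x)| |].
- by apply/funext => y; rewrite big_cons.
- by apply/diff_derivable/smooth_differentiable.
- by apply/diff_derivable/smooth_differentiable/smooth_sum.
Qed.

Lemma smooth_coord V (m n : nat) (f : V -> 'M[R]_(m, n)) i j :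
  smooth f -> smooth (fun x => f x i j).
Proof.
move=> fs k.
apply: (@class_C_comp_lin R V 'M[R]_(m, n) R k (@mx_coord R m n i j)) => //.
exact: coord_continuous.
Qed.

Lemma smooth_fst_coord V V' (m n : nat) (f : V -> 'M[R]_(m, n)) i j :
  smooth f -> smooth (fun z : V * V' => f z.1 i j).
Proof.
move=> fs k; have fk := smooth_coord i j fs k.
apply: (@class_C_lin_comp R (V * V')%type V R k (fun x => f x i j) fst) => //.
exact: fst_continuous.
Qed.

Lemma smooth_snd_coord V n i : smooth (fun z : V * 'cV[R]_n => z.2 i 0).
Proof.
apply: smooth_coord => k.
apply: (@class_C_lin R (V * 'cV[R]_n)%type 'cV[R]_n k snd).
exact: snd_continuous.
Qed.

Lemma smooth_mul_snd V n (M : 'rV[R]_n) :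
  smooth (fun z : V * 'cV[R]_n => (M *m z.2) 0 0).
Proof.
apply: (@eq_smooth _ _ (fun z : V * 'cV[R]_n => \sum_k M 0 k * z.2 k 0)).
  by move=> z; rewrite mxE.
apply: smooth_sum => k; apply: smoothM; first exact: smooth_cst.
exact: smooth_snd_coord.
Qed.

Lemma derive_mul_snd V n (M : 'rV[R]_n) (z w : V * 'cV[R]_n) :
  'D_w (fun z : V * 'cV[R]_n => (M *m z.2) 0 0) z = (M *m w.2) 0 0.
Proof.
apply: (@derive_lin R (V * 'cV[R]_n)%type R
   (@mx_coord R _ _ 0 0 \o (mulmx M \o snd))).
(* Continuity is smoothness at order 0. *)
exact: (smooth_mul_snd V M 0%N).
Qed.

End Smooth.

(** * Lie derivatives along the fault-extended system *)

Section Plant.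
Variables (R : realType) (n no p : nat).
Variables (F G : 'cV[R]_n -> 'cV[R]_n) (H J : 'cV[R]_n -> 'cV[R]_p).
Hypotheses (Fs : smooth F) (Gs : smooth G) (Hs : smooth H) (Js : smooth J).
Variables (Ro : 'M[R]_no) (Q : 'rV[R]_no).
Local Notation state := ('cV[R]_n * 'cV[R]_no)%type.
Local Notation L := (L_Fe F G Ro Q).

Lemma derive_partials (h : state -> R) (z : state) u v :
  differentiable h z ->
  'D_(u, v) h z =
  \sum_k u k 0 * partial_x k h z + \sum_k v k 0 * partial_xo k h z.
Proof.
move=> dh.
have -> : (u, v) = \sum_k u k 0 *: ((delta_mx k 0, 0) : state) +
                   \sum_k v k 0 *: ((0, delta_mx k 0) : state).
  apply/eqP; rewrite -pair_eqE /=; apply/andP.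
  rewrite !(raddf_sum fst, raddf_sum snd) /=.
  split; apply/eqP/colP => i.
  - rewrite mxE !summxE (bigD1 i) //= !mxE !eqxx mulr1 big1 => [|k ki].
      by rewrite big1 ?addr0 // => k _; rewrite scaler0 mxE.
    by rewrite !mxE eq_sym (negPf ki) mulr0.
  - rewrite mxE !summxE [X in _ + X](bigD1 i) //= !mxE !eqxx mulr1.
    rewrite [X in _ + (_ + X)]big1.
      by rewrite big1 ?addr0 ?add0r // => k _; rewrite scaler0 mxE.
    by move=> k ki; rewrite !mxE eq_sym (negPf ki) mulr0.
rewrite deriveE // linearD !linear_sum /=; congr (_ + _); apply: eq_bigr => k _;
by rewrite linearZ /partial_x /partial_xo deriveE.
Qed.

Lemma jacobian_mulE nu (T : state -> 'cV[R]_nu) z u v i :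
  differentiable (fun w => T w i 0) z ->
  (jacobian_x T z *m u + jacobian_xo T z *m v) i 0 =
  'D_(u, v) (fun w => T w i 0) z.
Proof.
move=> dT; rewrite derive_partials // !mxE.
by congr (_ + _); apply: eq_bigr => k _; rewrite mxE mulrC.
Qed.

(** [L_Fe] is a genuine Lie derivative: this is what makes it additive on smooth
    functions and identifies it with the rows of the observer condition. *)
Lemma L_FeE (h : state -> R) x xo : smooth h ->
  L h (x, xo) = 'D_(F x + G x *m (Q *m xo), Ro *m xo) h (x, xo).
Proof.
move=> hs; rewrite derive_partials ?{}/L_Fe; last exact: smooth_differentiable.
congr (_ + _); last first.
  by apply: eq_bigr => k _; rewrite -row_mul [in RHS]mxE mxE [in LHS]mxE.
rewrite mulr_sumr -big_split /=; apply: eq_bigr => k _.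
by rewrite [(F x + _) k 0]mxE [(G x *m _) k 0]mxE big_ord1 mulrDl mulrCA mulrA.
Qed.

Lemma smooth_L_Fe (h : state -> R) : smooth h -> smooth (L h).
Proof.
move=> hs.
have Ps k : smooth (partial_x k h) by exact: smooth_derive.
have Pos k : smooth (partial_xo k h) by exact: smooth_derive.
apply: (@eq_smooth _ _ _ (fun z =>
   \sum_k F z.1 k 0 * partial_x k h z
  + (Q *m z.2) 0 0 * (\sum_k G z.1 k 0 * partial_x k h z)
  + \sum_k (row k Ro *m z.2) 0 0 * partial_xo k h z)); first by case.
apply: smoothD; [apply: smoothD|].
- by apply: smooth_sum => k; apply: smoothM => //; exact: smooth_fst_coord.
- apply: smoothM; first exact: smooth_mul_snd.
  by apply: smooth_sum => k; apply: smoothM => //; exact: smooth_fst_coord.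
- by apply: smooth_sum => k; apply: smoothM => //; exact: smooth_mul_snd.
Qed.

Lemma smooth_betaH b : smooth (@betaH R n no p H J Q b).
Proof.
apply: (@eq_smooth _ _ _ (fun z : state => \sum_k b 0 k *
   (H z.1 k 0 + J z.1 k 0 * (Q *m z.2) 0 0))).
  by move=> [x xo]; rewrite /betaH /= [RHS]mxE; apply: eq_bigr => k _;
     rewrite [(H x + _) k 0]mxE [(J x *m _) k 0]mxE big_ord1.
apply: smooth_sum => k; apply: smoothM; first exact: smooth_cst.
apply: smoothD; first exact: smooth_fst_coord.
apply: smoothM; last exact: smooth_mul_snd.
exact: smooth_fst_coord.
Qed.

Lemma betaHB b c a (z : state) :
  betaH H J Q (b - a *: c) z = betaH H J Q b z - a * betaH H J Q c z.
Proof.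
rewrite /betaH mulmxBl -scalemxAl [in LHS]mxE [X in _ + X = _]mxE.
by rewrite [X in _ - X = _]mxE.
Qed.

Lemma smooth_iter_L k h : smooth h -> smooth (iter k L h).
Proof. by move=> hs; elim: k => //= k; exact: smooth_L_Fe. Qed.

(** * The recursion satisfied by the observer coordinates *)

Variables (alpha : nat -> R) (beta : nat -> 'rV[R]_p).

Definition lie_sum j (z : state) : R :=
  \sum_(0 <= l < j.+1) iter (j - l) L (betaH H J Q (beta l)) z.

Definition fault_poly j (z : state) : R :=
  (Q *m alpha_poly alpha Ro j *m z.2) 0 0.

Lemma smooth_lie_sum j : smooth (lie_sum j).
Proof. by apply: smooth_sum => l; apply/smooth_iter_L/smooth_betaH. Qed.

Lemma smooth_fault_poly j : smooth (fault_poly j).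
Proof. exact: smooth_mul_snd. Qed.

Lemma L_lie_sum j z :
  L (lie_sum j) z = lie_sum j.+1 z - betaH H J Q (beta j.+1) z.
Proof.
case: z => x xo.
have sm l : smooth (iter (j - l) L (betaH H J Q (beta l))).
  exact/smooth_iter_L/smooth_betaH.
rewrite L_FeE; last exact: smooth_lie_sum.
rewrite derive_sum_seq // /lie_sum [in RHS]big_nat_recr //= subnn addrK.
by apply: eq_big_nat => l /andP[_ lj]; rewrite -L_FeE // subSn.
Qed.

(** Horner's rule. *)
Lemma alpha_polyS j :
  alpha_poly alpha Ro j.+1 = alpha_poly alpha Ro j *m Ro + (alpha j.+1)%:M.
Proof.
rewrite /alpha_poly big_nat_recr //= subnn expr0 exprSr mulmxDl addrA.
rewrite scalemx1 mulmx_suml; congr (_ + _ + _).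
by apply: eq_big_nat => l /andP[_ lj]; rewrite subSn // exprSr -scalemxAl.
Qed.

Lemma L_fault_poly j z :
  L (fault_poly j) z = fault_poly j.+1 z - alpha j.+1 * (Q *m z.2) 0 0.
Proof.
case: z => x xo; rewrite L_FeE; last exact: smooth_fault_poly.
(* The x_o-component of the vector field is Ro x_o, which supplies the factor Ro
   of the recursion for P_j. *)
rewrite derive_mul_snd /fault_poly /= alpha_polyS mulmxDr mulmxDl.
rewrite mul_mx_scalar -scalemxAl [X in _ = X - _]mxE [X in _ + X - _]mxE addrK.
by rewrite !mulmxA.
Qed.

(** The coordinates of T counted from the last one: T_i is [obs_coord (nu - i)]
    for i = 1, ..., nu.  The index nu, which is not a coordinate, gives the
    defect of the equation that the beta_l have to satisfy. *)
Definition obs_coord j (z : state) : R := fault_poly j z - lie_sum j z.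

Lemma smooth_obs_coord j : smooth (obs_coord j).
Proof.
apply: (@eq_smooth _ _ _ (fun z => fault_poly j z + -1 * lie_sum j z)).
  by move=> z; rewrite mulN1r.
apply: smoothD; first exact: smooth_fault_poly.
by apply: smoothM; [exact: smooth_cst | exact: smooth_lie_sum].
Qed.

Lemma derive_obs_coord j w z :
  'D_w (obs_coord j) z = 'D_w (fault_poly j) z - 'D_w (lie_sum j) z.
Proof.
apply: deriveB; apply/diff_derivable/smooth_differentiable.
- exact: smooth_fault_poly.
- exact: smooth_lie_sum.
Qed.

Lemma obs_coord0 z :
  obs_coord 0 z = (Q *m z.2) 0 0 - betaH H J Q (beta 0%N) z.
Proof.
rewrite /obs_coord /fault_poly /lie_sum /alpha_poly big_geq // big_nat1 /=.
by rewrite expr0 addr0 mulmx1.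
Qed.

(** The observer condition for one coordinate.  Replacing the fault Q x_o by the
    estimate t_0 + beta_0 Htilde of [obs_coord0] is what turns beta_(j+1) into
    the coefficient beta_(j+1) - alpha_(j+1) beta_0 of B. *)
Lemma L_obs_coord j z :
  L (obs_coord j) z = obs_coord j.+1 z - alpha j.+1 * obs_coord 0 z
    + betaH H J Q (beta j.+1 - alpha j.+1 *: beta 0%N) z.
Proof.
have -> : L (obs_coord j) z = L (fault_poly j) z - L (lie_sum j) z.
  case: z => x xo; rewrite !L_FeE ?derive_obs_coord //.
  - exact: smooth_lie_sum.
  - exact: smooth_fault_poly.
  - exact: smooth_obs_coord.
rewrite L_fault_poly L_lie_sum obs_coord0 {1}/obs_coord.
rewrite betaHB; ring.
Qed.

Lemma obs_T_row nu (i : 'I_nu) :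
  (fun w => @obs_T R n no p nu F G H J Ro Q alpha beta w i 0) =
  obs_coord (nu - i.+1).
Proof. by apply/funext => z; rewrite mxE. Qed.

Variables (m : nat) (E : 'cV[R]_n -> 'M[R]_(n, m)).

Lemma L_E_lie_sum j z :
  L_E E (lie_sum j) z =
  \sum_(0 <= l < j.+1) L_E E (iter (j - l) L (betaH H J Q (beta l))) z.
Proof.
rewrite /L_E -mulmx_suml; congr (_ *m _); apply/rowP => k.
rewrite mxE summxE /partial_x derive_sum_seq => [|l].
  by apply: eq_bigr => l _; rewrite mxE.
exact/smooth_iter_L/smooth_betaH.
Qed.

(** The disturbance enters through x only, and the part of the coordinate that
    is linear in x_o has no derivative in x. *)
Lemma L_E_obs_coord j z : L_E E (obs_coord j) z = - L_E E (lie_sum j) z.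
Proof.
rewrite /L_E -mulNmx; congr (_ *m _); apply/rowP => k.
rewrite !mxE /partial_x derive_obs_coord derive_mul_snd /=.
by rewrite mulmx0 mxE sub0r.
Qed.

End Plant.

(** * The observer matrices *)

(** For i > 0 the one below the diagonal selects the previous entry, t (nu - i).
    Row 0 has no such one, so the same formula holds there only if t nu
    vanishes. *)
Lemma obs_A_mul (R : realType) nu (alpha t : nat -> R) (i : 'I_nu) :
  t nu = 0 ->
  (obs_A nu alpha *m \col_(j < nu) t (nu - j.+1)%N) i 0 =
  t (nu - i)%N - alpha (nu - i)%N * t 0%N.
Proof.
case: nu i => [[]//|nu] i tnu; rewrite mxE big_ord_recr /= !mxE /= eqxx subnn.
rewrite mulNr; congr (_ - _).
case: i => -[|i] lti /=.
  rewrite subn0 tnu big1 // => j _.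
  by rewrite !mxE /= ltn_eqF // mul0r.
have lti' : (i < nu)%N by [].
rewrite (bigD1 (Ordinal lti')) //= !mxE /= ltn_eqF // eqxx mul1r.
rewrite big1 ?addr0 // => j /eqP ji; rewrite !mxE /= ltn_eqF // eqSS.
by case: eqP => [ij|]; [case: ji; apply: val_inj | rewrite mul0r].
Qed.

Lemma obs_C_mul (R : realType) nu (t : nat -> R) : (0 < nu)%N ->
  (obs_C R nu *m \col_(j < nu) t (nu - j.+1)%N) 0 0 = t 0%N.
Proof.
case: nu => // nu _; rewrite mxE big_ord_recr /= !mxE eqxx subnn mul1r.
rewrite big1 ?add0r // => j _.
by rewrite !mxE /= ltn_eqF // mul0r.
Qed.

Lemma row_jacobian_mul (R : realType) n no nu m (E : 'cV[R]_n -> 'M[R]_(n, m))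
    (T : 'cV[R]_n * 'cV[R]_no -> 'cV[R]_nu) z i :
  row i (jacobian_x T z *m E z.1) = L_E E (fun w => T w i 0) z.
Proof.
by rewrite row_mul /L_E; congr (_ *m _); apply/rowP => k; rewrite !mxE.
Qed.

Lemma row_obs_B (R : realType) nu p alpha (beta : nat -> 'rV[R]_p) (i : 'I_nu) :
  row i (obs_B nu alpha beta) = beta (nu - i)%N - alpha (nu - i)%N *: beta 0%N.
Proof. by apply/rowP => j; rewrite !mxE. Qed.

(** * The functional observer *)

Theorem proposition4 (R : realType) (n p m no nu : nat)
    (n_gt0 : (0 < n)%N) (p_gt0 : (0 < p)%N) (m_gt0 : (0 < m)%N)
    (no_gt0 : (0 < no)%N) (nu_gt0 : (0 < nu)%N)
    (F G : 'cV[R]_n -> 'cV[R]_n) (H J : 'cV[R]_n -> 'cV[R]_p)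
    (E : 'cV[R]_n -> 'M[R]_(n, m)) (K : 'cV[R]_n -> 'M[R]_(p, m))
    (F_smooth : smooth F) (G_smooth : smooth G)
    (H_smooth : smooth H) (J_smooth : smooth J)
    (E_smooth : smooth E) (K_smooth : smooth K)
    (Ro : 'M[R]_no) (Q : 'rV[R]_no)
    (alpha : nat -> R) (beta : nat -> 'rV[R]_p)
    (beta_eq : forall (x : 'cV[R]_n) (xo : 'cV[R]_no),
        \sum_(0 <= l < nu.+1)
          iter (nu - l) (L_Fe F G Ro Q) (betaH H J Q (beta l)) (x, xo)
        = (Q *m alpha_poly alpha Ro nu *m xo) 0 0) :
  let A := obs_A nu alpha in
  let B := obs_B nu alpha beta in
  let C := obs_C R nu in
  let D := obs_D beta in
  let T := @obs_T R n no p nu F G H J Ro Q alpha beta in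
  functional_observer_conditions F G H J Ro Q A B C D T
  /\ (disturbance_decoupling_conditions E K B D T
      <->
      forall (x : 'cV[R]_n) (xo : 'cV[R]_no),
        (forall kappa : nat, (1 <= kappa <= nu)%N ->
           \sum_(0 <= l < (nu - kappa).+1)
             L_E E (iter (nu - kappa - l) (L_Fe F G Ro Q)
                      (betaH H J Q (beta l))) (x, xo)
           + beta (nu - kappa + 1)%N *m K x = 0)
        /\ beta 0%N *m K x = 0).
Proof.
move=> A B C D T.
pose t := obs_coord F G H J Ro Q alpha beta.
have ts j : smooth (t j) by exact: smooth_obs_coord.
have t_nu z : t nu z = 0.
  by case: z => x xo; apply/eqP; rewrite subr_eq0 /lie_sum beta_eq.
have Trow i : (fun w => T w i 0) = t (nu - i.+1)%N by exact: obs_T_row.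
have BE i : row i B = beta (nu - i)%N - alpha (nu - i)%N *: beta 0%N.
  exact: row_obs_B.
split.
- move=> x xo.
  have TE : T (x, xo) = \col_(j < nu) t (nu - j.+1)%N (x, xo) by [].
  split; apply/colP => i.
    (* Coordinate i is t at index j = nu - i.+1, so the recursion leads to the
       index j.+1 = nu - i, the one that row i of A and of B carries. *)
    rewrite jacobian_mulE Trow; last exact: smooth_differentiable.
    rewrite -L_FeE // L_obs_coord -?subSn // subSS.
    rewrite [RHS]mxE TE (obs_A_mul alpha (t := t^~ _)) //; congr (_ - _ + _).
    by rewrite /betaH -BE -row_mul [LHS]mxE.
  rewrite ord1 mxE TE (obs_C_mul (t^~ _)) // [t _ _]obs_coord0.
  by rewrite /betaH subrK.
- have decouple_row x xo (i : 'I_nu) : beta 0%N *m K x = 0 ->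
      row i (- (jacobian_x T (x, xo) *m E x) + B *m K x) =
      \sum_(0 <= l < (nu - i.+1).+1)
        L_E E (iter (nu - i.+1 - l) (L_Fe F G Ro Q)
                 (betaH H J Q (beta l))) (x, xo)
      + beta (nu - i)%N *m K x.
    move=> b0K; rewrite linearD linearN /= (row_jacobian_mul E T (x, xo)).
    rewrite Trow L_E_obs_coord // opprK L_E_lie_sum //; congr (_ + _).
    by rewrite row_mul BE mulmxBl -scalemxAl b0K scaler0 subr0.
  split=> dec x xo; have [decT b0K] := dec x xo; split=> //.
    move=> [//|k] /= ltk; have := decouple_row x xo (Ordinal ltk) b0K.
    by rewrite decT row0 /= addn1 -subSn // subSS => <-.
  apply/row_matrixP => i; rewrite row0 decouple_row //.
  by have := decT i.+1 (ltn_ord i); rewrite addn1 -subSn // subSS.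
Qed.
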